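(* Let $\phi:\mathbb{N}\to\mathbb{R}^{+}$ be an arbitrary positive function and let $F(\phi)=\{x\in(0,1]: d_n(x)\ge \phi(n)\text{ for infinitely many } n\}$. Let $\mathcal{L}$ denote Lebesgue measure on $(0,1]$. If $\sum_{n=1}^{\infty}2^{-\phi(n)}<\infty$ then $\mathcal{L}(F(\phi))=0$, and if $\sum_{n=1}^{\infty}2^{-\phi(n)}=\infty$ then $\mathcal{L}(F(\phi))=1$.
   Context: $\mathbb{N}=\{1,2,3,\dots\}$. Every $x\in(0,1]$ has a unique expansion $x=\sum_{i=1}^{\infty}2^{-(d_1(x)+d_2(x)+\cdots+d_i(x))}$ with all $d_i(x)\in\mathbb{N}$ (the power-2-decaying Gauss-like expansion); this defines the digit functions $d_i:(0,1]\to\mathbb{N}$. Equivalently, with $T:(0,1]\to(0,1]$ given by $Tx=2^nx-1$ for $x\in(2^{-n},2^{-(n-1)}]$, $n\in\mathbb{N}$, the digit $d_i(x)$ is the unique $n\in\mathbb{N}$ with $T^{i-1}x\in(2^{-n},2^{-(n-1)}]$. *)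

(* Defs.v *)
From HB Require Import structures.
From mathcomp Require Import all_boot all_order all_algebra.
From mathcomp Require Import all_classical all_reals all_analysis.

Set Implicit Arguments.
Unset Strict Implicit.
Unset Printing Implicit Defensive.

Import Order.TTheory GRing.Theory Num.Theory.
Import numFieldNormedType.Exports.

Local Open Scope classical_set_scope.
Local Open Scope ring_scope.

(* Digit sequences are indexed by 1, 2, 3, ...; position 0 is unused, and is
   set to 0 so that the expansion of x is unique as a function on nat. *)
Definition p2_expansion (R : realType) (x : R) (d : nat -> nat) : Prop :=
  [/\ d 0%N = 0%N,
      forall i, (1 <= i)%N -> (1 <= d i)%N &
      \sum_(1 <= i < n.+1) (2 : R) ^- (\sum_(1 <= j < i.+1) d j)%N
        @[n --> \oo] --> x].

(* Junk value 0 when x is not in (0, 1], see [p2_digitP] below. *)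
Definition p2_digit (R : realType) (i : nat) (x : R) : nat :=
  xget (fun=> 0%N) (p2_expansion x) i.

Definition limsup_digit_set (R : realType) (phi : nat -> R) : set R :=
  [set x | 0 < x <= 1 /\
    infinite_set [set n | (1 <= n)%N /\ phi n <= (p2_digit n x)%:R]].

Section expansion.
Variable R : realType.
Implicit Types (x : R) (d : nat -> nat).

Let D d n := (\sum_(1 <= j < n.+1) d j)%N.
Let S d n : R := \sum_(1 <= i < n.+1) (2 : R) ^- D d i.

Let D0 d : D d 0 = 0%N.
Proof. by rewrite /D big_geq. Qed.

Let DS d n : D d n.+1 = (D d n + d n.+1)%N.
Proof. by rewrite /D big_nat_recr. Qed.

Let S0 d : S d 0 = 0.
Proof. by rewrite /S big_geq. Qed.

Let SS d n : S d n.+1 = S d n + 2 ^- D d n.+1.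
Proof. by rewrite /S big_nat_recr. Qed.

Let pow2_gt0 n : 0 < (2 : R) ^- n.
Proof. by rewrite invr_gt0 exprn_gt0. Qed.

Let pow2_le m n : (m <= n)%N -> (2 : R) ^- n <= 2 ^- m.
Proof.
by move=> mn; rewrite lef_pV2 ?posrE ?exprn_gt0// ler_eXn2l// ltr1n.
Qed.

Let pow2S n : (2 : R) ^- n.+1 + 2 ^- n.+1 = 2 ^- n.
Proof. by rewrite exprS invfM -mulrDl -{1 2}div1r -splitr mul1r. Qed.

Let S_bounds x d n : p2_expansion x d -> S d n < x <= S d n + 2 ^- D d n.
Proof.
move=> [_ d1 Sx].
have Sup m : S d (n + m) + 2 ^- D d (n + m) <= S d n + 2 ^- D d n.
  elim: m => [|m IHm]; first by rewrite addn0.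
  rewrite addnS; apply: le_trans IHm; rewrite SS -addrA lerD2l.
  have le : ((D d (n + m)).+1 <= D d (n + m).+1)%N.
    by rewrite DS -addn1 leq_add2l d1.
  by rewrite -(pow2S (D d (n + m))) lerD// pow2_le.
have Sdn m : S d n <= S d (n + m).
  elim: m => [|m IHm]; first by rewrite addn0.
  by rewrite addnS SS (le_trans IHm)// lerDl ltW.
have cS : S d @ \oo --> x by [].
have ndS : {homo S d : m p / (m <= p)%N >-> m <= p}.
  by apply/nondecreasing_seqP => m; rewrite SS lerDl ltW.
apply/andP; split.
  apply: (@lt_le_trans _ _ (S d n.+1)); first by rewrite SS ltrDl.
  rewrite -(cvg_lim _ cS)//; apply: nondecreasing_cvgn_le => //.
  by apply/cvg_ex; exists x.
rewrite -(cvg_lim _ cS)//; apply: limr_le; first by apply/cvg_ex; exists x.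
near=> m; have nm : (n <= m)%N by near: m; exact: nbhs_infty_ge.
rewrite -(subnKC nm); apply: le_trans (Sup (m - n)%N).
by rewrite lerDl ltW.
Unshelve. all: by end_near. Qed.

Lemma p2_expansion_unique x d d' :
  p2_expansion x d -> p2_expansion x d' -> d = d'.
Proof.
move=> xd xd'; apply/funext => n.
suff : D d n = D d' n /\ d n = d' n by case.
have dd' e e' m : p2_expansion x e -> p2_expansion x e' ->
    D e m = D e' m -> S e m = S e' m -> (e' m.+1 <= e m.+1)%N.
  move=> xe xe' De Se; rewrite leqNgt; apply/negP => ltee'.
  have /andP[lx _] := S_bounds m.+1 xe.
  have /andP[_ xu] := S_bounds m.+1 xe'.
  have := lt_le_trans lx xu; rewrite !SS -addrA Se ltrD2l ltNge => /negP; apply.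
  have le : ((D e m.+1).+1 <= D e' m.+1)%N by rewrite !DS De -addnS leq_add2l.
  by rewrite -(pow2S (D e m.+1)) lerD// pow2_le.
suff H : [/\ D d n = D d' n, S d n = S d' n & d n = d' n] by case: H.
elim: n => [|n [De Se _]].
  by split; rewrite ?D0 ?S0//; case: xd => -> _ _; case: xd'.
have eqd : d n.+1 = d' n.+1.
  by apply/eqP; rewrite eqn_leq !dd'.
have DSe : D d n.+1 = D d' n.+1 by rewrite !DS De eqd.
by split => //; rewrite !SS Se DSe.
Qed.

Let first_digit x : 0 < x <= 1 ->
  exists k, (1 <= k)%N /\ (2 : R) ^- k < x <= 2 ^- k.-1.
Proof.
move=> /andP[x0 x1].
have ex : exists k, (2 : R) ^- k < x.
  exists (Num.truncn x^-1).+1; rewrite -[ltRHS]invrK.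
  rewrite ltf_pV2 ?posrE ?exprn_gt0 ?invr_gt0//.
  apply: lt_trans (truncnS_gt _) _.
  by rewrite -natrX ltr_nat ltn_expl.
case: (ex_minnP ex) => k kx kmin; exists k.
have k0 : (0 < k)%N.
  by rewrite lt0n; apply/eqP => k0; move: kx; rewrite k0 expr0 invr1 ltNge x1.
split=> //; rewrite kx/= leNgt; apply/negP => /kmin.
by rewrite leqNgt prednK// leqnn.
Qed.

Lemma p2_expansion_exists x : 0 < x <= 1 -> exists d, p2_expansion x d.
Proof.
move=> x01.
have /choice[k kP] : forall y : R, exists k, 0 < y <= 1 ->
    (1 <= k)%N /\ (2 : R) ^- k < y <= 2 ^- k.-1.
  move=> y; case: (boolP (0 < y <= 1)) => [/first_digit[k ?]|_]; last by exists 0%N.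
  by exists k.
pose T y : R := 2 ^+ k y * y - 1.
have T01 y : 0 < y <= 1 -> 0 < T y <= 1.
  move=> /kP[k1 /andP[ky yk]]; rewrite /T subr_gt0 lerBlDr; apply/andP; split.
    by rewrite -(@ltr_pM2l _ (2 ^- k y))// mulr1 mulKf// expf_neq0.
  rewrite -(@ler_pM2l _ (2 ^- k y))// mulKf ?expf_neq0//.
  by rewrite mulrDr mulr1 -{1 2}(prednK k1) pow2S.
have it01 n : 0 < iter n T x <= 1 by elim: n => //= n; exact: T01.
pose d n := if n is m.+1 then k (iter m T x) else 0%N.
have xE n : x = S d n + 2 ^- D d n * iter n T x.
  elim: n => [|n IHn]; first by rewrite S0 D0 expr0 invr1 add0r mul1r.
  rewrite {1}IHn SS DS /= -addrA; congr (_ + _).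
  rewrite /T mulrBr mulr1 [RHS]addrC subrK exprD invfM -mulrA; congr (_ * _).
  by rewrite mulKf// expf_neq0.
have d1 i : (1 <= i)%N -> (1 <= d i)%N.
  by case: i => // i _; have [] := kP _ (it01 i).
have nD n : (n <= D d n)%N.
  elim: n => [|n IHn]; first by rewrite D0.
  by rewrite DS -[leqLHS]addn1 leq_add// d1.
exists d; split => //.
suff : S d @ \oo --> x by [].
apply/cvgrPdist_le => e e0.
have : (fun n => (2^-1 : R) ^+ n) @ \oo --> 0.
  by apply: cvg_expr; rewrite ger0_norm ?invr_ge0// invf_lt1 ?ltr1n.
move=> /cvgrPdist_le/(_ _ e0); apply: filterS => n; rewrite sub0r normrN.
rewrite ger0_norm ?exprn_ge0 ?invr_ge0// exprVn => ne.
have /andP[it0 it1] := it01 n.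
rewrite {1}(xE n) addrC addKr ger0_norm; last by rewrite mulr_ge0// ltW.
apply: le_trans (le_trans (pow2_le (nD n)) ne).
by rewrite -[leRHS]mulr1 ler_pM2l.
Qed.

Lemma p2_digitP x : 0 < x <= 1 -> p2_expansion x (fun i => p2_digit i x).
Proof. by move=> /p2_expansion_exists; exact: xgetPex. Qed.

End expansion.

(* Main.v *)
(* Write mu for Lebesgue measure on (0, 1] and T x = 2^(d_1 x) x - 1.  On each
   interval where d_1 = k, T is affine of slope 2^k onto (0, 1], so that
   mu {d_1 <= t, T x in E} = (1 - 2^-t) mu E: the digits are independent with
   mu {d_n > t} = 2^-t.  Let s_n be the natural number with
   s_n < phi n <= s_n + 1; then d_n >= phi n iff d_n > s_n, and 2^-(s_n) is
   2^-(phi n) up to a factor 2.  Convergence is the first Borel-Cantelli lemma.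
   For divergence, mu {d_n <= s_n for all n <= N} is the product of the
   1 - 2^-(s_n), which is at most 1 / (1 + sum of the 2^-(s_n)) and so tends
   to 0; pulling back by T^m gives the same for the tails. *)
Require Import Defs.
From HB Require Import structures.
From mathcomp Require Import all_boot all_order all_algebra.
From mathcomp Require Import all_classical all_reals all_analysis.
From mathcomp Require Import measurable_realfun lra.

Set Implicit Arguments.
Unset Strict Implicit.
Unset Printing Implicit Defensive.

Import Order.TTheory GRing.Theory Num.Theory.
Import numFieldNormedType.Exports.

Local Open Scope classical_set_scope.
Local Open Scope ring_scope.

(** * Lebesgue measure under affine maps *)

Section affine.
Variable R : realType.
Local Notation mu := (@lebesgue_measure R).

Lemma measurable_affine (a b : R) :
  measurable_fun [set: R] (fun x : R => a * x + b : R).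
Proof. exact: measurable_funD. Qed.

(** By uniqueness of Lebesgue measure: [a] times the pushforward of [mu] agrees with [mu] on
    half-open intervals. *)
Lemma lebesgue_measure_affine (a b : R) (A : set R) : 0 < a -> measurable A ->
  mu ((fun x => a * x + b) @^-1` A) = (a^-1%:E * mu A)%E.
Proof.
move=> a0 mA.
suff -> : mu A = (a%:E * mu ((fun x => a * x + b)%R @^-1` A))%E.
  by rewrite muleA -EFinM mulVf ?gt_eqF// mul1e.
pose f (x : measurableTypeR R) : measurableTypeR R := a * x + b.
have mf : measurable_fun setT f by exact: measurable_affine.
have scaled_unique (nu : {measure set (measurableTypeR R) -> \bar R}) :
    (forall X, ocitv X -> mu X = (a%:E * nu X)%E) -> mu A = (a%:E * nu A)%E.
  by move=> munu; exact: (@lebesgue_measure_unique _ (mscale (NngNum (ltW a0)) nu)).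
rewrite -[in RHS]/(pushforward mu f A).
apply: scaled_unique => _ [[c d]] _ <-.
change (mu `]c, d] = a%:E * mu ((fun x => a * x + b)%R @^-1` `]c, d]))%E.
rewrite [X in (_ * mu X)%E](_ : _ = `](c - b) / a, (d - b) / a]%classic); last first.
  apply/seteqP; split => x /=; rewrite !in_itv/= ltr_pdivrMr// ler_pdivlMr//;
    by rewrite ltrBlDr lerBrDr mulrC.
rewrite !lebesgue_measure_itv/= !lte_fin ltr_pM2r ?invr_gt0// ltrD2r.
case: ifPn => _; last by rewrite mule0.
rewrite -!EFinB -EFinM -mulrBl mulrC divfK ?gt_eqF//; congr (_%:E); lra.
Qed.

Lemma lebesgue_measure_unit : mu `]0, 1] = 1%E.
Proof. by rewrite lebesgue_measure_itv/= lte_fin ltr01 oppr0 adde0. Qed.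

End affine.

(** * The digit shift [T] and its invariance *)

Section shift.
Variable R : realType.
Implicit Types (x : R) (E : set R).

(** Prepending [k] to the digits of [y = 2^k x - 1] gives an expansion of [x = 2^-k + 2^-k y], and
    expansions are unique. *)
Lemma p2_digit_affine k x : (1 <= k)%N -> 0 < 2 ^+ k * x - 1 <= 1 ->
  [/\ 0 < x <= 1, p2_digit 1 x = k &
    forall n, p2_digit n.+2 x = p2_digit n.+1 (2 ^+ k * x - 1)].
Proof.
move=> k1 y01; set y := 2 ^+ k * x - 1 in y01 *.
have xE : x = 2 ^- k + 2 ^- k * y.
  by rewrite /y mulrBr mulr1 addrC subrK mulKf// expf_neq0.
have [_ dy1 cy] := p2_digitP y01.
pose d n := if n is m.+1 then if m is _.+1 then p2_digit m y else k else 0%N.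
have dsum i : (\sum_(1 <= j < i.+2) d j = k + \sum_(1 <= j < i.+1) p2_digit j y)%N.
  rewrite big_nat_recl//=; congr addn.
  by apply: eq_big_nat => -[|j].
have xd : p2_expansion x d.
  split => //; first by move=> [|[|i]]// _; exact: dy1.
  (* Shifting by one splits off the term [2^-k]; the rest is [2^-k] times a partial sum for [y]. *)
  rewrite -(cvg_shiftn 1)/= xE.
  have : (2 ^- k + 2 ^- k * \sum_(1 <= i < n.+1)
      (2 : R) ^- (\sum_(1 <= j < i.+1) p2_digit j y)%N) @[n --> \oo] --> 2 ^- k + 2 ^- k * y.
    by apply: cvgD; [exact: cvg_cst|apply: cvgM => //; exact: cvg_cst].
  apply: cvg_trans; apply: near_eq_cvg; apply: nearW => n /=.
  rewrite addn1 [RHS]big_nat_recl//= big_nat1; congr +%R.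
  rewrite mulr_sumr; apply: eq_big_nat => -[|i]// _.
  by rewrite dsum exprD invfM.
have x01 : 0 < x <= 1.
  move/andP: y01 => [y0 y1]; rewrite xE addr_gt0 ?mulr_gt0 ?invr_gt0 ?exprn_gt0//=.
  rewrite -[X in X + _]mulr1 -mulrDr ler_pdivrMl ?exprn_gt0// mulr1.
  apply: (@le_trans _ _ (2 ^+ 1)); first by rewrite expr1; lra.
  by rewrite ler_eXn2l// ltr1n.
have dE := p2_expansion_unique (p2_digitP x01) xd.
have dE' n : p2_digit n x = d n by rewrite -[RHS]/(d n) -dE.
by split => // [|n]; rewrite dE'.
Qed.

(** Take the least [k] with [1 < 2^k x]; minimality gives [2^k x <= 2], and [x <= 1] rules out
    [k = 0]. *)
Lemma p2_affine_exists x : 0 < x <= 1 ->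
  exists2 k, (1 <= k)%N & 0 < 2 ^+ k * x - 1 <= 1.
Proof.
move=> /andP[x0 x1].
have ex : exists k, 1 < 2 ^+ k * x.
  exists (Num.truncn x^-1).+1; rewrite -ltr_pdivrMr// mul1r.
  apply: lt_trans (truncnS_gt _) _.
  by rewrite -natrX ltr_nat ltn_expl.
case: (ex_minnP ex) => -[|k] kx kmin.
  by move: kx; rewrite expr0 mul1r ltNge x1.
exists k.+1 => //; rewrite subr_gt0 kx/= lerBlDr.
have : 2 ^+ k * x <= 1 by rewrite leNgt; apply/negP => /kmin; rewrite ltnn.
by rewrite exprS -mulrA; lra.
Qed.

Definition p2_shift x : R := 2 ^+ p2_digit 1 x * x - 1.

Lemma p2_shiftP x : 0 < x <= 1 ->
  [/\ (1 <= p2_digit 1 x)%N, 0 < p2_shift x <= 1 &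
    forall n, p2_digit n.+2 x = p2_digit n.+1 (p2_shift x)].
Proof.
move=> /p2_affine_exists[k k1 kx]; have [_ dk dS] := p2_digit_affine k1 kx.
by rewrite /p2_shift dk.
Qed.

(** Bounding the first digit, rather than fixing it, makes these sets increase with [s] to the
    [T]-preimage of [E] in [(0, 1]]. *)
Definition p2_cyl (s : nat) E : set R :=
  [set x | [/\ 0 < x <= 1, (p2_digit 1 x <= s)%N & E (p2_shift x)]].

Definition p2_preshift E : set R := [set x | 0 < x <= 1 /\ E (p2_shift x)].

Lemma p2_cyl0 E : p2_cyl 0 E = set0.
Proof.
apply/seteqP; split => x //= -[/p2_shiftP[d1 _ _]].
by rewrite leqn0 => /eqP d0; rewrite d0 in d1.
Qed.

(** As [E] lies in [(0, 1]], having [2^(s+1) x - 1] in [E] already forces [x] into [(0, 1]] with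
    first digit [s + 1]. *)
Lemma p2_cylS s E : E `<=` `]0, 1] ->
  p2_cyl s.+1 E = p2_cyl s E `|` (fun x => 2 ^+ s.+1 * x - 1) @^-1` E.
Proof.
move=> E01; apply/seteqP; split => x /=.
  move=> [x01]; rewrite leq_eqVlt => /predU1P[ds|ds Ex]; last by left.
  by rewrite /p2_shift ds => ?; right.
move=> [[x01 ds Ex]|Ex]; first by split => //; exact: leq_trans ds _.
have := E01 _ Ex; rewrite /= in_itv/= => y01.
have [x01 d1 _] := p2_digit_affine (ltn0Sn s) y01.
by split => //; rewrite ?d1// /p2_shift d1.
Qed.

Lemma p2_preshiftE E : p2_preshift E = \bigcup_s p2_cyl s E.
Proof.
apply/seteqP; split => x /= [].
  by move=> x01 Ex; exists (p2_digit 1 x).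
by move=> s _ [].
Qed.

Local Notation mu := (@lebesgue_measure R).

(** Each digit value [k] from 1 to [s] adds a disjoint piece of measure [2^-k mu E]. *)
Lemma p2_cyl_measure s E : measurable E -> E `<=` `]0, 1] ->
  measurable (p2_cyl s E) /\ mu (p2_cyl s E) = ((1 - 2 ^- s)%:E * mu E)%E.
Proof.
move=> mE E01; elim: s => [|s [mC IHs]].
  by rewrite p2_cyl0 measure0 expr0 invr1 subrr mul0e; split.
have mB : measurable ((fun x => 2 ^+ s.+1 * x - 1) @^-1` E).
  by rewrite -[X in measurable X]setTI; exact: measurable_affine.
rewrite p2_cylS//; split; first exact: measurableU.
rewrite measureU//; last first.
  apply/seteqP; split => x //= [[x01 ds _] /E01]; rewrite /= in_itv/= => y01.
  have [_ dk _] := p2_digit_affine (ltn0Sn s) y01.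
  by rewrite dk ltnn in ds.
rewrite [X in (_ + X)%E]lebesgue_measure_affine// [X in (X + _)%E]IHs.
rewrite -ge0_muleDl//; last first.
- by rewrite lee_fin subr_ge0 invf_le1 ?exprn_gt0// exprn_ege1// ler1n.
rewrite -EFinD; congr (_%:E * _)%E; rewrite exprS invfM; lra.
Qed.

(** Continuity from below, letting [s] grow in [p2_cyl_measure]. *)
Lemma p2_preshift_measure E : measurable E -> E `<=` `]0, 1] ->
  measurable (p2_preshift E) /\ mu (p2_preshift E) = mu E.
Proof.
move=> mE E01; rewrite p2_preshiftE.
have mC s : measurable (p2_cyl s E) by have [] := p2_cyl_measure s mE E01.
have mU : measurable (\bigcup_s p2_cyl s E) by exact: bigcup_measurable.
split => //.
have := @nondecreasing_cvg_mu _ _ _ mu _ mC mU; move/(_ _)/cvg_lim => <-//; last first.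
  apply/nondecreasing_seqP => s; apply/subsetPset => x [x01 ds Ex].
  by split => //; exact: leq_trans ds _.
apply/cvg_lim => //.
have -> : mu \o (fun s => p2_cyl s E) = (fun s => (1 - 2 ^- s)%:E * mu E)%E.
  by apply/funext => s /=; have [] := p2_cyl_measure s mE E01.
have Efin : mu E \is a fin_num.
  rewrite ge0_fin_numE//; apply: (@le_lt_trans _ _ (mu `]0, 1])).
    by rewrite le_measure ?inE.
  by rewrite lebesgue_measure_unit ltry.
rewrite -[X in _ --> X]mul1e; apply: cvgeZr => //.
apply: cvg_EFin; first exact: nearW.
rewrite -[X in _ --> X]subr0; apply: cvgB; first exact: cvg_cst.
under eq_fun do rewrite -exprVn.
by apply: cvg_expr; rewrite ger0_norm ?invr_ge0// invf_lt1 ?ltr1n.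
Qed.

End shift.

(** * Measures of digit events *)

Section digit_events.
Variable R : realType.
Implicit Types (s : nat -> nat).
Local Notation mu := (@lebesgue_measure R).

Definition digit_gt n t : set R :=
  [set x | 0 < x <= 1 /\ (t < p2_digit n.+1 x)%N].

(** The first-digit event is the complement of a [p2_cyl] set; each later one is the [T]-preimage of
    its predecessor. *)
Lemma digit_gt_measure n t :
  measurable (digit_gt n t) /\ mu (digit_gt n t) = (2 ^- t)%:E.
Proof.
elim: n => [|n [mD IHn]].
  have sub01 : `]0, 1]%classic `<=` (`]0, 1] : set R) by [].
  have [mC muC] := p2_cyl_measure t (measurable_itv `]0, 1]) sub01.
  have -> : digit_gt 0 t = `]0, 1] `\` p2_cyl t `]0, 1].
    apply/seteqP; split => x /=.
      by move=> [x01 td]; split; rewrite /= ?in_itv// => -[_]; rewrite leqNgt td.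
    rewrite in_itv/= => -[x01 nC]; split => //; rewrite ltnNge; apply/negP => dt; apply: nC.
    by have [_ y01 _] := p2_shiftP x01; split; rewrite //= in_itv.
  split; first exact: measurableD.
  rewrite measureD//; last by rewrite [X in (X < _)%E]lebesgue_measure_unit ltry.
  rewrite setIidr; last by move=> x []; rewrite /= in_itv.
  rewrite [X in (_ - X)%E]muC [X in (X - _)%E]lebesgue_measure_unit.
  rewrite lebesgue_measure_unit mule1.
  by rewrite -EFinB subKr.
have D01 : digit_gt n t `<=` `]0, 1] by move=> x []; rewrite /= in_itv.
have [mP muP] := p2_preshift_measure mD D01.
have -> : digit_gt n.+1 t = p2_preshift (digit_gt n t).
  apply/seteqP; split => x [x01] /=; have [_ y01 dS] := p2_shiftP x01.
    by rewrite dS.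
  by move=> [_]; rewrite -dS.
by split; rewrite // muP IHn.
Qed.

Definition digits_le s j : set R :=
  [set x | 0 < x <= 1 /\ forall i, (i < j)%N -> (p2_digit i.+1 x <= s i)%N].

(** Independence by induction: the first bound gives one factor through [p2_cyl_measure], the others
    form an event for [T x] with [s] shifted. *)
Lemma digits_le_measure s j : measurable (digits_le s j) /\
  mu (digits_le s j) = (\prod_(i < j) (1 - 2 ^- s i))%:E.
Proof.
elim: j s => [|j IHj] s.
  have -> : digits_le s 0 = `]0, 1]%classic.
    by apply/seteqP; split => x /=; rewrite in_itv/=; [case|].
  by rewrite big_ord0 lebesgue_measure_unit; split.
have [mL muL] := IHj (s \o S).
have L01 : digits_le (s \o S) j `<=` `]0, 1] by move=> x []; rewrite /= in_itv.
have [mC muC] := p2_cyl_measure (s 0) mL L01.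
have -> : digits_le s j.+1 = p2_cyl (s 0) (digits_le (s \o S) j).
  apply/seteqP; split => x /=.
    move=> [x01 ds]; have [_ y01 dS] := p2_shiftP x01; split => //.
      exact: (ds 0).
    by split => // i ij; rewrite -dS; exact: (ds i.+1).
  move=> [x01 ds [_ dl]]; have [_ y01 dS] := p2_shiftP x01; split => // -[|i]//.
  by rewrite ltnS dS; exact: dl.
by split; rewrite // muC muL -EFinM big_ord_recl.
Qed.

(* Elementary substitute for 1 - p <= exp (- p). *)
Lemma prod1B_sum (p : nat -> R) j : (forall i, 0 <= p i <= 1) ->
  (\prod_(i < j) (1 - p i)) * (1 + \sum_(i < j) p i) <= 1.
Proof.
move=> p01; elim: j => [|j IHj]; first by rewrite !big_ord0 mul1r addr0.
apply: le_trans IHj; rewrite !big_ord_recr/= -mulrA ler_wpM2l//.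
  by rewrite prodr_ge0// => i _; have := p01 i; lra.
have S0 : 0 <= \sum_(i < j) p i.
  by rewrite sumr_ge0// => i _; have := p01 i; lra.
by have /andP[] := p01 j; nra.
Qed.

Lemma digits_le_all_measure s :
  (forall M : R, exists j, M <= \sum_(i < j) 2 ^- s i) ->
  measurable (\bigcap_j digits_le s j) /\ mu (\bigcap_j digits_le s j) = 0%E.
Proof.
move=> sum_oo.
have mL j : measurable (digits_le s j) by have [] := digits_le_measure s j.
have mI : measurable (\bigcap_j digits_le s j) by exact: bigcap_measurable.
split => //; apply/eqP; rewrite -measure_le0; apply/lee_addgt0Pr => e e0.
(* With partial sum [S >= 1/e] and product [P], [P (1 + S) <= 1] gives [P <= e P S <= e]. *)
rewrite add0e; have [j Mj] := sum_oo e^-1.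
apply: (@le_trans _ _ (mu (digits_le s j))).
  apply: le_measure; rewrite ?inE; [exact: mI|exact: mL|].
  by move=> x; apply.
have [_ ->] := digits_le_measure s j; rewrite lee_fin.
have p01 i : 0 <= (2 : R) ^- s i <= 1.
  by rewrite invr_ge0 exprn_ge0//= invf_le1 ?exprn_gt0// exprn_ege1// ler1n.
have := prod1B_sum j p01.
have P0 : 0 <= \prod_(i < j) (1 - (2 : R) ^- s i).
  by rewrite prodr_ge0// => i _; have := p01 i; lra.
set P := \prod_(i < j) _ in P0 *; set S := \sum_(i < j) _ in Mj * => PS.
have eS : 1 <= e * S by rewrite -ler_pdivrMl// mulr1.
nra.
Qed.

Definition digits_le_from s m : set R :=
  [set x | 0 < x <= 1 /\ forall i, (m <= i)%N -> (p2_digit i.+1 x <= s i)%N].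

(** Induction on [m]: the event from [m + 1] on is the [T]-preimage of the event from [m] on for the
    shifted sequence. *)
Lemma digits_le_from_measure s m :
  (forall M : R, exists j, M <= \sum_(i < j) 2 ^- s i) ->
  measurable (digits_le_from s m) /\ mu (digits_le_from s m) = 0%E.
Proof.
elim: m s => [|m IHm] s sum_oo.
  have -> : digits_le_from s 0 = \bigcap_j digits_le s j.
    apply/seteqP; split => x /=.
      by move=> [x01 ds] j _; split => // i _; exact: ds.
    move=> ds; have [x01 _] := ds 0 I; split => // i _.
    by have [_] := ds i.+1 I; exact.
  exact: digits_le_all_measure.
have sum_oo' (M : R) : exists j, M <= \sum_(i < j) 2 ^- (s \o S) i.
  (* The dropped term is at most 1, so [1 + M] is a sufficient target. *)
  have [[|j] Mj] := sum_oo (1 + M).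
    by exists 0; move: Mj; rewrite !big_ord0; lra.
  exists j; move: Mj; rewrite big_ord_recl/=.
  have : (2 : R) ^- s 0 <= 1.
    by rewrite invf_le1 ?exprn_gt0// exprn_ege1// ler1n.
  set X := \sum_(i < j) _; lra.
have [mF muF] := IHm _ sum_oo'.
have F01 : digits_le_from (s \o S) m `<=` `]0, 1].
  by move=> x []; rewrite /= in_itv.
have [mP muP] := p2_preshift_measure mF F01.
have -> : digits_le_from s m.+1 = p2_preshift (digits_le_from (s \o S) m).
  apply/seteqP; split => x [x01] /=; have [_ y01 dS] := p2_shiftP x01.
    by move=> ds; split => //; split => // i mi; rewrite -dS; exact: (ds i.+1).
  by move=> [_ ds]; split => // -[|i]// mi; rewrite dS; exact: ds.
by split; rewrite // muP muF.
Qed.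

End digit_events.

(** * The limsup set and the two Borel-Cantelli cases *)

Section limsup.
Variables (R : realType) (phi : nat -> R) (s : nat -> nat).
Hypothesis phi_s : forall n, (s n)%:R < phi n.+1 <= (s n).+1%:R.
Local Notation mu := (@lebesgue_measure R).

Lemma limsup_digit_setE :
  limsup_digit_set phi = lim_sup_set (fun n => @digit_gt R n (s n)).
Proof.
have dE n d : phi n.+1 <= d%:R = (s n < d)%N.
  have /andP[sp ps] := phi_s n; apply/idP/idP => [pd|sd].
    by rewrite -(ltr_nat R); exact: lt_le_trans pd.
  by apply: le_trans ps _; rewrite ler_nat.
apply/seteqP; split => x /=.
  move=> [x01 inf] m _.
  (* Some index survives removal of those up to [m]; written [n + 1], it has [m <= n]. *)
  have [[|n] /= [[]]// _ pd] := infinite_setN0 (infinite_setD inf (finite_II m.+1)).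
  rewrite ltnS => /negP; rewrite -leqNgt => mn; exists n => //; split => //.
  by rewrite -dE.
move=> sup; split; first by have [n _ []] := sup 0 I.
(* An event past the maximum of a finite list [l] of all indices would put a larger index in [l]. *)
move=> /finite_seqP[l lE]; have [n /= ln [_]] := sup (\max_(i <- l) i)%N I.
rewrite -dE => pd.
have nl : n.+1 \in l by change ([set` l] n.+1); rewrite -lE.
by have := @leq_bigmax_seq _ l xpredT id _ nl isT; rewrite leqNgt ltnS ln.
Qed.

Lemma limsup_digit_set_measure0 :
  (\sum_(n <oo) (2 ^- s n)%:E < +oo :> \bar R)%E ->
  mu (limsup_digit_set phi) = 0%E.
Proof.
move=> fin; rewrite limsup_digit_setE; apply: lim_sup_set_cvg0.
  by move=> n; have [] := @digit_gt_measure R n (s n).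
apply: le_lt_trans fin; rewrite le_eqVlt; apply/orP; left; apply/eqP.
apply: eq_eseriesr => n _; exact: (digit_gt_measure R n (s n)).2.
Qed.

Lemma limsup_digit_set_measure1 :
  (\sum_(n <oo) (2 ^- s n)%:E = +oo :> \bar R)%E ->
  mu (limsup_digit_set phi) = 1%E.
Proof.
move=> sum_oo.
have unbounded (M : R) : exists j, M <= \sum_(i < j) 2 ^- s i.
  apply/not_existsP => bnd; move: sum_oo => /eqP; apply/negP.
  rewrite -ltey; apply: (@le_lt_trans _ _ M%:E); last exact: ltry.
  apply: lime_le; first by apply: is_cvg_nneseries.
  apply: nearW => j; rewrite big_mkord sumEFin lee_fin ltW// ltNge.
  exact/negP/bnd.
have mF m := digits_le_from_measure m unbounded.
(* A point of [(0, 1]] escapes the limsup set exactly when its digits obey [s] from some index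
   on. *)
have -> : limsup_digit_set phi = `]0, 1] `\` \bigcup_m @digits_le_from R s m.
  rewrite limsup_digit_setE; apply/seteqP; split => x /=.
    move=> sup; split.
      by rewrite in_itv/=; have [n _ []] := sup 0 I.
    move=> [m _ [_ ds]]; have [n/= mn [_]] := sup m I.
    by rewrite ltnNge ds.
  rewrite in_itv/= => -[x01 nF] m _; apply: contrapT => nsup.
  apply: nF; exists m => //; split => // i mi.
  rewrite leqNgt; apply/negP => si; apply: nsup.
  by exists i.
have mU : measurable (\bigcup_m @digits_le_from R s m).
  by apply: bigcup_measurable => m _; have [] := mF m.
have U0 : mu (\bigcup_m @digits_le_from R s m) = 0%E.
  apply/negligibleP => //; apply: negligible_bigcup => m.
  by apply/negligibleP; have [] := mF m.
rewrite measureD//; last by rewrite [X in (X < _)%E]lebesgue_measure_unit ltry.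
rewrite [X in (_ - X)%E](_ : _ = 0%E); last first.
  by apply: subset_measure0 U0 => //; exact: measurableI.
by rewrite sube0; exact: lebesgue_measure_unit.
Qed.

End limsup.

(** * Integer thresholds and comparison of the series *)

Lemma exists_ceil (R : realType) (y : R) : 0 < y ->
  exists s : nat, s%:R < y <= s.+1%:R.
Proof.
move=> y0; have ex : exists n, y <= n%:R.
  by exists (Num.truncn y).+1; exact/ltW/truncnS_gt.
case: (ex_minnP ex) => -[|s] ys smin; first by move: ys; rewrite leNgt y0.
exists s; rewrite ys andbT ltNge; apply/negP => /smin.
by rewrite ltnn.
Qed.

Theorem theorem1p1 (R : realType) (phi : nat -> R)
    (phi_gt0 : forall n : nat, (1 <= n)%N -> 0 < phi n) :
  ((\sum_(1 <= n <oo) ((2 `^ (- phi n))%:E) < +oo)%E ->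
     lebesgue_measure (limsup_digit_set phi) = 0%E) /\
  ((\sum_(1 <= n <oo) ((2 `^ (- phi n))%:E) = +oo)%E ->
     lebesgue_measure (limsup_digit_set phi) = 1%E).
Proof.
have /choice[s phi_s] : forall n, exists s : nat, s%:R < phi n.+1 <= s.+1%:R.
  by move=> n; apply: exists_ceil; exact: phi_gt0.
have p0 n : (0 <= (2 `^ (- phi n))%:E :> \bar R)%E by rewrite lee_fin powR_ge0.
have s0 n : (0 <= (2 ^- s n)%:E :> \bar R)%E by rewrite lee_fin invr_ge0 exprn_ge0.
rewrite -nneseries_addn//; under eq_eseriesr do rewrite addn1.
have powN n : 2 ^- n = 2 `^ (- n%:R) :> R.
  by rewrite powRN powR_mulrn.
(* This bound, from [s n < phi n.+1], transfers divergence; the next, from [phi n.+1 <= s n + 1],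
   transfers convergence. *)
have le_s n : ((2 `^ (- phi n.+1))%:E <= (2 ^- s n)%:E :> \bar R)%E.
  by rewrite lee_fin powN ler_powR ?ler1n// lerN2; have /andP[/ltW] := phi_s n.
have s_le n : ((2 ^- s n)%:E <= 2%:E * (2 `^ (- phi n.+1))%:E :> \bar R)%E.
  rewrite -EFinM lee_fin -ler_pdivrMl// -invfM -exprS powN.
  by rewrite ler_powR ?ler1n// lerN2; have /andP[] := phi_s n.
split => [fin|dvg].
  apply: (limsup_digit_set_measure0 phi_s).
  apply: (@le_lt_trans _ _ (\sum_(n <oo) (2%:E * (2 `^ (- phi n.+1))%:E))%E).
    exact: lee_nneseries.
  by rewrite nneseriesZl// lte_mul_pinfty// lee_fin.
apply: (limsup_digit_set_measure1 phi_s); apply/eqP.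
rewrite -leye_eq -dvg; exact: lee_nneseries.
Qed.
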